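(* Let $(M,g)$ be a smooth two-dimensional Riemannian manifold, let $\Omega$ be the area form associated to $g$ and let $\nabla$ be the gradient associated to $g$. Let $X_{\epsilon,\lambda}=F_\lambda Z_\lambda+\epsilon Q_\lambda+O(\epsilon^2)$ be a smooth slow-fast family of vector fields near $p\in M$ satisfying Assumptions A1--A3 (stated in the context; it suffices that A3 holds for $\lambda=\lambda_0$), and let $p_\lambda$ be the associated family of generic contact points, for $\lambda$ near $\lambda_0$. Then the function $$\mathcal{G}_\lambda=\Omega(Q_\lambda,Z_\lambda)\cdot\Omega\big(\nabla F_\lambda,\nabla (Z_\lambda F_\lambda)\big)$$ on $S_\lambda=\{F_\lambda=0\}$ and the value $$\mathcal{A}_\lambda=\left.\frac{Z_\lambda^3(F_\lambda)}{\big(Z_\lambda^2(F_\lambda)\big)^2}\right|_{p_\lambda}$$ are well-defined, are coordinate-free notions, and are independent of the choice of the triplet $(F_\lambda,Z_\lambda,Q_\lambda)$ within its factorization equivalence class. Furthermore, $\mathcal{G}_{\lambda_0}$ does not depend on the choice of the metric $g$.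
   Context: Setting. $X_{\epsilon,\lambda}$ is a smooth family of vector fields on a smooth surface $M$, defined near $p\in M$, for $\epsilon\in[0,\epsilon_0)$ and $\lambda$ in an open neighbourhood $\Lambda\subset\mathbf{R}^n$ of $\lambda_0$, written as $X_{\epsilon,\lambda}=F_\lambda Z_\lambda+\epsilon Q_\lambda+O(\epsilon^2)$ with $F_\lambda$ a smooth family of scalar functions and $Z_\lambda,Q_\lambda$ smooth families of vector fields. The critical curve is $S_\lambda=\{q: F_\lambda(q)=0\}$. Everything is local near $p$ (all statements are on a small neighbourhood of $p$, on which an orientation is chosen so that area forms make sense). Vector fields are identified with Lie derivatives: $V(f)=\mathcal{L}_Vf$, $V^2(f)=V(V(f))$, $V^3(f)=V(V(V(f)))$; $Z_\lambda F_\lambda=Z_\lambda(F_\lambda)$. Assumption A1: near $p$ the critical curve is a smooth regular curve, with $dF_\lambda\neq0$ along it, and $p\in S_{\lambda_0}$. Assumption A2: $Z_\lambda(p)\neq 0$. Assumption A3: $p$ is a generic contact point for $\lambda=\lambda_0$: $F_{\lambda_0}(p)=0$, $Z_{\lambda_0}(F_{\lambda_0})(p)=0$, $Z_{\lambda_0}^2(F_{\lambda_0})(p)\neq0$. Under A1--A3 it is known that there is a smooth map $\lambda\mapsto p_\lambda\in M$ near $\lambda_0$ with $p_{\lambda_0}=p$ and $F_\lambda(p_\lambda)=0$, $Z_\lambda(F_\lambda)(p_\lambda)=0$, $Z_\lambda^2(F_\lambda)(p_\lambda)\neq0$. Factorization equivalence: the triplets $(F_\lambda,Z_\lambda,Q_\lambda)$,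 $(F_\lambda,Z_\lambda,Q_\lambda+cZ_\lambda)$ for a smooth scalar function $c$, and $(bF_\lambda,b^{-1}Z_\lambda,Q_\lambda)$ for a nowhere zero smooth scalar function $b$, are all considered equivalent ($Q_\lambda$ only matters through its restriction to $S_\lambda$). *)

(* Defs.v *)
From HB Require Import structures.
From mathcomp Require Import all_boot all_order all_algebra.
From mathcomp Require Import all_classical all_reals all_analysis.
Set Implicit Arguments.
Unset Strict Implicit.
Unset Printing Implicit Defensive.
Import Order.TTheory GRing.Theory Num.Theory.
Import numFieldNormedType.Exports.
Local Open Scope classical_set_scope.
Local Open Scope ring_scope.

(* In finite dimension and for k >= 1, a function is C^k on an open set D iff
   it is differentiable there and all its directional derivatives are
   C^(k-1). *)
Fixpoint Ck (R : realType) (V W : normedModType R) (k : nat)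
    (D : set V) (f : V -> W) : Prop :=
  match k with
  | 0%N => forall x, D x -> {for x, continuous f}
  | k'.+1 => (forall x, D x -> differentiable f x) /\
             (forall v : V, Ck k' D (fun x => 'd f x v))
  end.

(* Smoothness on an arbitrary subset D: existence, around each point of D, of a
   smooth extension; for open D this is ordinary smoothness.  Non-open D are
   used for the parameter range [0, e0[. *)
Definition smooth_on (R : realType) (V W : normedModType R)
    (D : set V) (f : V -> W) : Prop :=
  forall x, D x -> exists (B : set V) (h : V -> W),
    [/\ open B, B x, (forall k, Ck k B h) &
        forall y, B y -> D y -> f y = h y].

(* cmap and cinv are total; only their values on cdom and cmap @` cdom are
   relevant. *)
Record chart (R : realType) (M : topologicalType) := Chart {
  cdom : set M;
  cmap : M -> 'rV[R]_2;
  cinv : 'rV[R]_2 -> M;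
  cdom_open : open cdom;
  crng_open : open (cmap @` cdom);
  cmapK : forall q, cdom q -> cinv (cmap q) = q;
  cmap_cts : forall q, cdom q -> {for q, continuous cmap};
  cinv_cts : forall x, (cmap @` cdom) x -> {for x, continuous cinv} }.

Definition crng (R : realType) (M : topologicalType) (a : chart R M) :
  set 'rV[R]_2 := cmap a @` cdom a.

Definition trans (R : realType) (M : topologicalType) (a b : chart R M) :
  'rV[R]_2 -> 'rV[R]_2 := cmap b \o cinv a.

Definition compatible (R : realType) (M : topologicalType) (a b : chart R M) :=
  smooth_on (cmap a @` (cdom a `&` cdom b)) (trans a b) /\
  smooth_on (cmap b @` (cdom a `&` cdom b)) (trans b a).

Record smooth_surface (R : realType) := SmoothSurface {
  carrier :> topologicalType;
  surface_hausdorff : hausdorff_space carrier;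
  surface_second_countable : @second_countable carrier;
  atlas : set (chart R carrier);
  atlas_cover : forall q : carrier, exists2 a, atlas a & cdom a q;
  atlas_compatible : forall a b, atlas a -> atlas b -> compatible a b;
  atlas_maximal : forall a, (forall b, atlas b -> compatible a b) -> atlas a }.

(* A vector field is given by its components in every chart, subject to the
   transformation law is_vfield. *)
Definition vfield (R : realType) (M : smooth_surface R) :=
  chart R M -> M -> 'rV[R]_2.

Definition is_vfield (R : realType) (M : smooth_surface R) (U : set M)
    (V : vfield M) : Prop :=
  forall a b q, atlas a -> atlas b -> U q -> cdom a q -> cdom b q ->
    V b q = 'd (trans a b) (cmap a q) (V a q).

Definition smooth_ffam (R : realType) (M : smooth_surface R)
    (P : normedModType R) (L : set P) (U : set M) (f : P -> M -> R) : Prop :=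
  forall a, atlas a ->
    @smooth_on R (P * 'rV[R]_2)%type R^o
      [set y | L y.1 /\ (cmap a @` (cdom a `&` U)) y.2]
      (fun y => f y.1 (cinv a y.2)).

Definition smooth_vfam (R : realType) (M : smooth_surface R)
    (P : normedModType R) (L : set P) (U : set M) (V : P -> vfield M) : Prop :=
  (forall l, L l -> is_vfield U (V l)) /\
  (forall a, atlas a ->
    @smooth_on R (P * 'rV[R]_2)%type 'rV[R]_2
      [set y | L y.1 /\ (cmap a @` (cdom a `&` U)) y.2]
      (fun y => V y.1 a (cinv a y.2))).

(* The row vector of partial derivatives of f in the chart a, i.e. the
   components of df. *)
Definition dform (R : realType) (M : smooth_surface R) (a : chart R M)
    (f : M -> R) (q : M) : 'rV[R]_2 :=
  \row_j 'd (f \o cinv a : 'rV[R]_2 -> R^o) (cmap a q) (delta_mx 0 j).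

(* The Lie derivative V(f), as computed in the chart a. *)
Definition lie (R : realType) (M : smooth_surface R) (a : chart R M)
    (V : vfield M) (f : M -> R) : M -> R :=
  fun q => 'd (f \o cinv a : 'rV[R]_2 -> R^o) (cmap a q) (V a q).

(* A Riemannian metric is given by its Gram matrix in every chart. *)
Definition tensor2 (R : realType) (M : smooth_surface R) :=
  chart R M -> M -> 'M[R]_2.

Definition inner (R : realType) (M : smooth_surface R) (g : tensor2 M)
    (a : chart R M) (q : M) (v w : 'rV[R]_2) : R :=
  (v *m g a q *m w^T) 0 0.

Definition is_metric (R : realType) (M : smooth_surface R) (g : tensor2 M) :=
  [/\ (forall a, atlas a -> smooth_on (crng a) (fun x => g a (cinv a x))),
      (forall a q, atlas a -> cdom a q -> (g a q)^T = g a q),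
      (forall a q v, atlas a -> cdom a q -> v != 0 -> 0 < inner g a q v v) &
      (forall a b q v w, atlas a -> atlas b -> cdom a q -> cdom b q ->
        inner g a q v w = inner g b q ('d (trans a b) (cmap a q) v)
                                      ('d (trans a b) (cmap a q) w))].

(* o a q is 1 or -1 according to whether the coordinates a are positively or
   negatively oriented at q. *)
Definition is_orientation (R : realType) (M : smooth_surface R) (U : set M)
    (o : chart R M -> M -> R) : Prop :=
  forall a q, atlas a -> U q -> cdom a q ->
    [/\ o a q = 1 \/ o a q = -1,
        {for q, continuous (o a : M -> R^o)} &
        forall b, atlas b -> cdom b q ->
          o b q = Num.sg (\det (jacobian (trans a b) (cmap a q))) * o a q].

Definition area_form (R : realType) (M : smooth_surface R) (g : tensor2 M)
    (o : chart R M -> M -> R) (a : chart R M) (q : M) (v w : 'rV[R]_2) : R :=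
  o a q * Num.sqrt (\det (g a q)) * (v 0 0 * w 0 1 - v 0 1 * w 0 0).

(* The solution of g(grad f, v) = df(v) for all v. *)
Definition grad (R : realType) (M : smooth_surface R) (g : tensor2 M)
    (f : M -> R) : vfield M :=
  fun a q => dform a f q *m invmx (g a q).

Record triplet (R : realType) (n : nat) (M : smooth_surface R) := Triplet {
  tF : 'rV[R]_n -> M -> R;
  tZ : 'rV[R]_n -> vfield M;
  tQ : 'rV[R]_n -> vfield M }.

Definition smooth_triplet (R : realType) (n : nat) (M : smooth_surface R)
    (L : set 'rV[R]_n) (U : set M) (T : triplet n M) : Prop :=
  [/\ smooth_ffam L U (tF T), smooth_vfam L U (tZ T) & smooth_vfam L U (tQ T)].

Definition crit_curve (R : realType) (n : nat) (M : smooth_surface R)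
    (U : set M) (T : triplet n M) (l : 'rV[R]_n) : set M :=
  [set q | U q /\ tF T l q = 0].

(* The remainder X - F Z - e Q is O(e^2) as e -> 0+, locally uniformly. *)
Definition slow_fast (R : realType) (n : nat) (M : smooth_surface R)
    (e0 : R) (L : set 'rV[R]_n) (U : set M)
    (X : R^o * 'rV[R]_n -> vfield M) (T : triplet n M) : Prop :=
  [/\ smooth_vfam [set y | 0 <= y.1 < e0 /\ L y.2] U X,
      smooth_triplet L U T &
      forall a l q, atlas a -> L l -> U q -> cdom a q ->
        exists C : R, \forall y \near ((0 : R^o), l, q), 0 <= y.1.1 ->
          `| X y.1 a y.2 - tF T y.1.2 y.2 *: tZ T y.1.2 a y.2
               - y.1.1 *: tQ T y.1.2 a y.2 | <= C * y.1.1 ^+ 2].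

(* An embedded one-dimensional submanifold. *)
Definition regular_curve (R : realType) (M : smooth_surface R) (S : set M) :=
  forall q, S q -> exists a,
    [/\ atlas a, cdom a q & forall q', cdom a q' -> (S q' <-> cmap a q' 0 1 = 0)].

Definition generic_contact (R : realType) (n : nat) (M : smooth_surface R)
    (T : triplet n M) (l : 'rV[R]_n) (q : M) : Prop :=
  tF T l q = 0 /\
  forall a, atlas a -> cdom a q ->
    lie a (tZ T l) (tF T l) q = 0 /\
    iter 2 (lie a (tZ T l)) (tF T l) q != 0.

Definition A1 (R : realType) (n : nat) (M : smooth_surface R)
    (L : set 'rV[R]_n) (U : set M) (T : triplet n M) (l0 : 'rV[R]_n) (p : M) :=
  [/\ crit_curve U T l0 p,
      (forall l, L l -> regular_curve (crit_curve U T l)) &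
      forall l q a, L l -> crit_curve U T l q -> atlas a -> cdom a q ->
        dform a (tF T l) q != 0].

Definition A2 (R : realType) (n : nat) (M : smooth_surface R)
    (L : set 'rV[R]_n) (T : triplet n M) (p : M) :=
  forall l a, L l -> atlas a -> cdom a p -> tZ T l a p != 0.

Definition A3 (R : realType) (n : nat) (M : smooth_surface R)
    (T : triplet n M) (l0 : 'rV[R]_n) (p : M) := generic_contact T l0 p.

(* c is a smooth map l |-> p_l near l0, with p_(l0) = p, consisting of generic
   contact points. *)
Definition contact_family (R : realType) (n : nat) (M : smooth_surface R)
    (L : set 'rV[R]_n) (U : set M) (T : triplet n M) (l0 : 'rV[R]_n) (p : M)
    (c : 'rV[R]_n -> M) : Prop :=
  c l0 = p /\
  exists B : set 'rV[R]_n,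
    [/\ open B, B l0, (forall l, B l -> {for l, continuous c}),
        (forall a, atlas a -> smooth_on [set l | B l /\ cdom a (c l)] (cmap a \o c)) &
        forall l, B l -> [/\ L l, U (c l) & generic_contact T l (c l)]].

(* The last move expresses that Q only matters through its restriction to the
   critical curve. *)
Inductive fact_equiv (R : realType) (n : nat) (M : smooth_surface R)
    (L : set 'rV[R]_n) (U : set M) : triplet n M -> triplet n M -> Prop :=
| fe_refl T : fact_equiv L U T T
| fe_sym T T' : fact_equiv L U T T' -> fact_equiv L U T' T
| fe_trans T T' T'' :
    fact_equiv L U T T' -> fact_equiv L U T' T'' -> fact_equiv L U T T''
| fe_addZ T T' (c : 'rV[R]_n -> M -> R) :
    smooth_ffam L U c ->
    (forall l q, L l -> U q -> tF T' l q = tF T l q) ->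
    (forall l a q, L l -> atlas a -> U q -> cdom a q ->
       tZ T' l a q = tZ T l a q /\
       tQ T' l a q = tQ T l a q + c l q *: tZ T l a q) ->
    fact_equiv L U T T'
| fe_scale T T' (b : 'rV[R]_n -> M -> R) :
    smooth_ffam L U b ->
    (forall l q, L l -> U q -> b l q != 0) ->
    (forall l q, L l -> U q -> tF T' l q = b l q * tF T l q) ->
    (forall l a q, L l -> atlas a -> U q -> cdom a q ->
       tZ T' l a q = (b l q)^-1 *: tZ T l a q /\
       tQ T' l a q = tQ T l a q) ->
    fact_equiv L U T T'
| fe_restrQ T T' :
    smooth_vfam L U (tQ T) -> smooth_vfam L U (tQ T') ->
    (forall l q, L l -> U q -> tF T' l q = tF T l q) ->
    (forall l a q, L l -> atlas a -> U q -> cdom a q ->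
       tZ T' l a q = tZ T l a q /\
       (tF T l q = 0 -> tQ T' l a q = tQ T l a q)) ->
    fact_equiv L U T T'.

Definition calG (R : realType) (n : nat) (M : smooth_surface R)
    (g : tensor2 M) (o : chart R M -> M -> R) (T : triplet n M)
    (a : chart R M) (l : 'rV[R]_n) (q : M) : R :=
  area_form g o a q (tQ T l a q) (tZ T l a q) *
  area_form g o a q (grad g (tF T l) a q)
                    (grad g (lie a (tZ T l) (tF T l)) a q).

Definition calA (R : realType) (n : nat) (M : smooth_surface R)
    (T : triplet n M) (a : chart R M) (l : 'rV[R]_n) (q : M) : R :=
  iter 3 (lie a (tZ T l)) (tF T l) q / iter 2 (lie a (tZ T l)) (tF T l) q ^+ 2.

(* Main.v *)
(* On {F = 0} a rescaling F' = b F, Z' = Z / b gives dF' = b dF and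
   d(Z'F') = d(ZF) + (Zb / b) dF, while Q' /\ Z' = (Q /\ Z) / b since Q changes
   by a multiple of Z; at a contact point moreover Z'^2 F' = Z^2 F / b and
   Z'^3 F' = Z^3 F / b^2.  Hence (Q /\ Z)(dF /\ d(ZF)) and Z^3 F / (Z^2 F)^2 are
   unchanged.  In a chart, Omega(Q, Z) is sqrt(det g) (Q /\ Z) and
   Omega(grad F, grad ZF) is sqrt(det g) det(g)^-1 (dF /\ d(ZF)), so the metric
   and the orientation cancel in their product; under a change of chart the two
   wedges pick up inverse Jacobian factors.  Two families of contact points
   through p coincide near l0 because dF and d(ZF) are independent at p, which
   makes (F, ZF) injective near p, uniformly in the parameter. *)

Require Import Defs.
From HB Require Import structures.
From mathcomp Require Import all_boot all_order all_algebra.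
From mathcomp Require Import all_classical all_reals all_analysis.
From mathcomp Require Import ring.
Set Implicit Arguments.
Unset Strict Implicit.
Unset Printing Implicit Defensive.
Import Order.TTheory GRing.Theory Num.Theory.
Import numFieldNormedType.Exports.
Local Open Scope classical_set_scope.
Local Open Scope ring_scope.

(** * Functions of class C^k *)

Section Differential.
Context {R : realType}.
Implicit Types V W : normedModType R.

(** The first-order expansion of [f] at [x] carries over to [g] on the neighbourhood where they
    agree, and uniqueness of the differential identifies the two. *)
Lemma near_eq_differentiable V W (f g : V -> W) (x : V) :
  (\forall y \near x, f y = g y) -> differentiable f x ->
  differentiable g x /\ 'd g x = 'd f x :> (V -> W).
Proof.
move=> fg df.
have fgx : g x = f x by rewrite (nbhs_singleton fg).
have /diff_locallyP[cf /eqaddoP ef] := df.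
have eg : g \o shift x = cst (g x) + 'd f x +o_ 0 id.
  apply/eqaddoP => e e0; have {}ef := ef e e0.
  have fg0 : \forall h \near 0, f (h + x) = g (h + x).
    by move: fg; rewrite (near_shift 0) subr0.
  by near=> h; rewrite !fctE/= fgx -(near fg0 h)//; exact: (near ef h).
have dgf : 'd g x = 'd f x :> (V -> W) by apply: diff_unique.
split; last exact: dgf.
by apply/diff_locallyP; rewrite dgf; split.
Unshelve. all: by end_near. Qed.

(** Openness of [D] turns equality on [D] into equality of germs at each of its points, which the
    differential respects. *)
Lemma Ck_ext V W k (D : set V) (f g : V -> W) :
  open D -> (forall x, D x -> f x = g x) -> Ck k D f -> Ck k D g.
Proof.
move=> oD; elim: k f g => [|k IH] f g fg /= => [cf x Dx|[df Cf]].
  have fgx : \forall y \near x, f y = g y.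
    by apply: filterS (open_nbhs_nbhs (conj oD Dx)) => y /fg.
  have := cf x Dx; rewrite /prop_for /continuous_at -(fg x Dx).
  by apply: cvg_trans; exact: near_eq_cvg.
have fgx x : D x -> \forall y \near x, f y = g y.
  by move=> Dx; apply: filterS (open_nbhs_nbhs (conj oD Dx)) => y /fg.
split=> [x Dx|v]; first by have [] := near_eq_differentiable (fgx x Dx) (df x Dx).
apply: IH (Cf v) => x Dx.
by have [_ ->] := near_eq_differentiable (fgx x Dx) (df x Dx).
Qed.

Lemma Ck_sub V W k (D E : set V) (f : V -> W) : E `<=` D -> Ck k D f -> Ck k E f.
Proof.
move=> ED; elim: k f => [|k IH] f /=; first by move=> Cf x /ED /Cf.
by move=> [df Cf]; split=> [x /ED /df//|v]; exact: IH.
Qed.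

(** [Ck] is a conjunction of conditions at the points of the set, each on the germ of the total
    function [f]; hence [B] may be any set containing [x]. *)
Lemma Ck_local V W k (D : set V) (f : V -> W) :
  (forall x, D x -> exists2 B : set V, B x & Ck k B f) -> Ck k D f.
Proof.
elim: k f => [|k IH] f /= h; first by move=> x /h[B Bx]; exact.
split=> [x /h[B Bx [+ _]]|v]; first exact.
by apply: IH => x /h[B Bx [_ /(_ v)]]; exists B.
Qed.

Lemma Ck_pred V W k (D : set V) (f : V -> W) : Ck k.+1 D f -> Ck k D f.
Proof.
elim: k f => [|k IH] f; first by move=> [df _] x /df; exact: differentiable_continuous.
by move=> [df Cf]; split=> // v; apply/IH/Cf.
Qed.

(** On an open set each local extension [h] coincides with [f] near the point, so its regularity
    passes to [f]. *)
Lemma smooth_onP V W (D : set V) (f : V -> W) : open D ->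
  smooth_on D f <-> forall k, Ck k D f.
Proof.
move=> oD; split=> [sf k|sf x Dx]; last by exists D, f; split.
apply: Ck_local => x Dx; have [B [h [oB Bx Ch fh]]] := sf x Dx.
exists (B `&` D) => //; apply: (@Ck_ext _ _ _ _ h); first exact: openI.
  by move=> y [By Dy]; rewrite fh.
by apply: Ck_sub (Ch k) => y [].
Qed.

Lemma Ck_cst V W k (D : set V) (a : W) : Ck k D (cst a).
Proof.
elim: k a => [|k IH] a /=; first by move=> x _; exact: cst_continuous.
split=> [x _|v]; first exact: differentiable_cst.
by rewrite (_ : (fun _ => _) = cst 0) //; apply/funext => x; rewrite diff_cst.
Qed.

Lemma Ck_add V W k (D : set V) (f g : V -> W) : open D ->
  Ck k D f -> Ck k D g -> Ck k D (fun x => f x + g x).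
Proof.
move=> oD; elim: k f g => [|k IH] f g /=.
  by move=> Cf Cg x Dx; apply: cvgD; [exact: Cf|exact: Cg].
move=> [df Cf] [dg Cg]; split=> [x Dx|v].
  by apply: (@differentiableD _ _ _ f g); [exact: df|exact: dg].
apply: Ck_ext (IH _ _ (Cf v) (Cg v)) => // x Dx.
exact: esym (congr1 (@^~ v) (diffD (df x Dx) (dg x Dx))).
Qed.

(** The Leibniz rule keeps one factor undifferentiated in each term; [Ck_pred] lowers that factor to
    the class of the induction hypothesis. *)
Lemma Ck_mul V k (D : set V) (f g : V -> R^o) : open D ->
  Ck k D f -> Ck k D g -> Ck k D (fun x => f x * g x : R^o).
Proof.
move=> oD; elim: k f g => [|k IH] f g.
  by move=> Cf Cg x Dx; apply: cvgM; [exact: Cf|exact: Cg].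
move=> Cf Cg; have [df dCf] := Cf; have [dg dCg] := Cg; split=> [x Dx|v].
  by apply: (@differentiableM _ _ f g); [exact: df|exact: dg].
have C1 := IH _ _ (Ck_pred Cf) (dCg v); have C2 := IH _ _ (Ck_pred Cg) (dCf v).
apply: Ck_ext (Ck_add oD C1 C2) => // x Dx.
exact: esym (congr1 (@^~ v) (diffM (df x Dx) (dg x Dx))).
Qed.

(** The derivative [- f^-2 df] involves only [f^-1] itself, already of the lower class by induction,
    and [df]. *)
Lemma Ck_inv V k (D : set V) (f : V -> R^o) : open D ->
  (forall x, D x -> f x != 0) -> Ck k D f -> Ck k D (fun x => (f x)^-1 : R^o).
Proof.
move=> oD f0; elim: k => [|k IH].
  by move=> Cf x Dx; apply: cvgV; [exact: f0|exact: Cf].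
move=> Cf; have [df dCf] := Cf; split=> [x Dx|v].
  by apply: (@differentiableV _ _ f); [exact: df|exact: f0].
have Ci := IH (Ck_pred Cf); have C1 := Ck_mul oD Ci Ci.
have C2 := Ck_mul oD (Ck_mul oD (Ck_cst k D (-1 : R^o)) C1) (dCf v).
apply: Ck_ext C2 => // x Dx; rewrite /= mulN1r -invfM -expr2.
exact: esym (congr1 (@^~ v) (diffV (df x Dx) (f0 x Dx))).
Qed.

Lemma Ck_linear V W W' k (D : set V) (f : V -> W) (h : {linear W -> W'}) :
  open D -> continuous h -> Ck k D f -> Ck k D (h \o f).
Proof.
move=> oD ch; elim: k f => [|k IH] f.
  by move=> Cf x Dx; apply: continuous_comp; [exact: Cf|exact: ch].
move=> [df Cf]; split=> [x Dx|v].
  by apply: differentiable_comp; [exact: df|exact: linear_differentiable].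
apply: Ck_ext (IH _ (Cf v)) => // x Dx.
rewrite /= -[in LHS](diff_lin (f x) ch).
exact: esym (congr1 (@^~ v) (diff_comp (df x Dx) (linear_differentiable _ ch))).
Qed.

End Differential.

(** * Rescaling of vector fields in coordinates *)

Lemma row2E (R : realType) (v : 'rV[R]_2) :
  v = v 0 0 *: delta_mx 0 0 + v 0 1 *: delta_mx 0 1.
Proof.
rewrite [LHS]row_sum_delta big_ord_recl big_ord1.
by congr (_ + v 0 _ *: delta_mx 0 _); exact: val_inj.
Qed.

(* Locked, because comparing two derivatives up to conversion unfolds the
   choice operator in the definition of the differential. *)
HB.lock Definition dder (R : realType) (V : normedModType R) (f : V -> R^o)
  (y v : V) : R^o := 'd f y v.

Lemma dderE (R : realType) (V : normedModType R) (f : V -> R^o) (y v : V) :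
  dder f y v = 'd f y v.
Proof. by rewrite dder.unlock. Qed.

(* The parameter l is carried along as the first component of y = (l, x). *)
Definition plie (R : realType) (P : normedModType R)
    (Z : P * 'rV[R]_2 -> 'rV[R]_2) (f : P * 'rV[R]_2 -> R^o) :
    P * 'rV[R]_2 -> R^o :=
  fun y => dder f y (0, Z y).

(** * Calculus of functions smooth in the parameter and the coordinates *)

Section ParametricLie.
Context {R : realType} {P : normedModType R}.
Variable D : set (P * 'rV[R]_2).
Hypothesis oD : open D.

Definition smooth (f : P * 'rV[R]_2 -> R^o) := forall k, Ck k D f.

Lemma smooth_diff f y : smooth f -> D y -> differentiable f y.
Proof. by move=> /(_ 1%N)[df _] /df. Qed.

Lemma smooth_dder f v : smooth f -> smooth (fun y => dder f y v).
Proof. by rewrite dder.unlock => sf k; have [_] := sf k.+1; exact. Qed.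

Lemma smooth_continuous f y : smooth f -> D y -> {for y, continuous f}.
Proof. by move=> sf; exact: (sf 0%N). Qed.

Lemma smooth_ext f g : (forall y, D y -> f y = g y) -> smooth f -> smooth g.
Proof. by move=> fg sf k; exact: Ck_ext (sf k). Qed.

Lemma smooth_mul f g : smooth f -> smooth g -> smooth (fun y => f y * g y).
Proof. by move=> sf sg k; exact: Ck_mul. Qed.

Lemma smooth_add f g : smooth f -> smooth g -> smooth (fun y => f y + g y).
Proof. by move=> sf sg k; exact: Ck_add. Qed.

Lemma smooth_inv f : (forall y, D y -> f y != 0) -> smooth f ->
  smooth (fun y => (f y)^-1).
Proof. by move=> f0 sf k; exact: Ck_inv. Qed.

Lemma d_ext f g y v : (forall y, D y -> f y = g y) -> smooth f -> D y ->
  dder g y v = dder f y v.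
Proof.
move=> fg sf Dy.
have fgy : \forall z \near y, f z = g z.
  by apply: filterS (open_nbhs_nbhs (conj oD Dy)) => z /fg.
have [_ E] := near_eq_differentiable fgy (smooth_diff sf Dy).
by rewrite !dderE; exact: (congr1 (@^~ v) E).
Qed.

Lemma d_mul f g y v : smooth f -> smooth g -> D y ->
  dder (fun y => f y * g y) y v = f y * dder g y v + g y * dder f y v.
Proof.
move=> sf sg Dy.
rewrite !dderE.
exact: (congr1 (@^~ v) (diffM (smooth_diff sf Dy) (smooth_diff sg Dy))).
Qed.

Lemma d_add f g y v : smooth f -> smooth g -> D y ->
  dder (fun y => f y + g y) y v = dder f y v + dder g y v.
Proof.
move=> sf sg Dy.
rewrite !dderE.
exact: (congr1 (@^~ v) (diffD (smooth_diff sf Dy) (smooth_diff sg Dy))).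
Qed.

Lemma d_inv f y v : (forall y, D y -> f y != 0) -> smooth f -> D y ->
  dder (fun y => (f y)^-1) y v = - (f y) ^- 2 * dder f y v.
Proof.
move=> f0 sf Dy.
rewrite !dderE.
exact: (congr1 (@^~ v) (diffV (smooth_diff sf Dy) (f0 y Dy))).
Qed.

Lemma d_row2 (f : P * 'rV[R]_2 -> R^o) y (v : 'rV[R]_2) : dder f y (0, v) =
  v 0 0 * dder f y (0, delta_mx 0 0) + v 0 1 * dder f y (0, delta_mx 0 1).
Proof.
have E : (0, v) = v 0 0 *: ((0, delta_mx 0 0) : P * 'rV[R]_2)
    + v 0 1 *: ((0, delta_mx 0 1) : P * 'rV[R]_2).
  by apply: injective_projections; [rewrite /= !scaler0 addr0|exact: row2E].
by rewrite !dderE E linearD !linearZ.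
Qed.

Definition smooth_vf (Z : P * 'rV[R]_2 -> 'rV[R]_2) :=
  forall j, smooth (fun y => Z y 0 j).

(** The derivative along [Z] is the combination of the two partial derivatives with the components
    of [Z] as coefficients. *)
Lemma smooth_plie Z f : smooth_vf Z -> smooth f -> smooth (plie Z f).
Proof.
move=> sZ sf.
pose g j y := Z y 0 j * dder f y (0, delta_mx 0 j).
have sg j : smooth (g j) by apply: smooth_mul => //; exact: smooth_dder.
apply: smooth_ext (smooth_add (sg 0) (sg 1)) => y _.
by rewrite /plie [RHS]d_row2.
Qed.

Lemma smooth_iter_plie Z f k : smooth_vf Z -> smooth f ->
  smooth (iter k (plie Z) f).
Proof. by move=> sZ sf; elim: k => // k IH; exact: smooth_plie. Qed.

Section Rescaling.
Variables (F b : P * 'rV[R]_2 -> R^o) (Z : P * 'rV[R]_2 -> 'rV[R]_2).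
Variables (F' : P * 'rV[R]_2 -> R^o) (Z' : P * 'rV[R]_2 -> 'rV[R]_2).
Hypotheses (sF : smooth F) (sb : smooth b) (sZ : smooth_vf Z).
Hypothesis b0 : forall y, D y -> b y != 0.
Hypothesis F'E : forall y, D y -> b y * F y = F' y.
Hypothesis Z'E : forall y, D y -> Z' y = (b y)^-1 *: Z y.

(** The logarithmic derivative of [b] along [Z]. *)
Let h y : R^o := (b y)^-1 * plie Z b y.

Let sbV : smooth (fun y => (b y)^-1).
Proof. exact: smooth_inv. Qed.

Let sh : smooth h.
Proof. by apply: smooth_mul => //; exact: smooth_plie. Qed.

Lemma smooth_rescaled : smooth F'.
Proof. by apply: (smooth_ext F'E); exact: smooth_mul. Qed.

Lemma smooth_vf_rescaled : smooth_vf Z'.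
Proof.
move=> j; apply: (smooth_ext _ (smooth_mul sbV (sZ j))) => y Dy.
by rewrite Z'E// mxE.
Qed.

(** The factor [1 / b] comes out by linearity in the field. Keeping [f] and [g] apart lets a closed
    form [f], valid on [D], replace an iterated derivative [g] before it is differentiated again. *)
Lemma plie_rescaled f g y : (forall y, D y -> f y = g y) -> smooth f -> D y ->
  plie Z' g y = (b y)^-1 * plie Z f y.
Proof.
move=> fg sf Dy; have -> : plie Z' g y = dder f y (0, Z' y) by exact: d_ext.
rewrite Z'E// /plie (d_row2 f y (_ *: _)) (d_row2 f y (Z y)) !mxE.
by rewrite -!mulrA -mulrDr.
Qed.

(** Closed form of [Z'F'] on all of [D]: values on the curve alone would not suffice to
    differentiate once more. [lie2] plays the same part for the second derivative. *)
Let lie1 y : R^o := plie Z F y + F y * h y.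

Let slie1 : smooth lie1.
Proof. by apply: smooth_add; [exact: smooth_plie|exact: smooth_mul]. Qed.

Let lie1E y : D y -> lie1 y = plie Z' F' y.
Proof.
move=> Dy; rewrite (plie_rescaled F'E)//; last exact: smooth_mul.
by rewrite /lie1 /h {3}/plie d_mul// mulrDr mulKf ?b0// mulrCA.
Qed.

Let lie2 y : R^o :=
  (b y)^-1 * (iter 2 (plie Z) F y + (F y * plie Z h y + h y * plie Z F y)).

Let slie2' : smooth (fun y =>
  iter 2 (plie Z) F y + (F y * plie Z h y + h y * plie Z F y)).
Proof.
apply: smooth_add; first exact: smooth_iter_plie.
by apply: smooth_add; apply: smooth_mul => //; exact: smooth_plie.
Qed.

Let lie2E y : D y -> lie2 y = iter 2 (plie Z') F' y.
Proof.
move=> Dy; rewrite -[RHS]/(plie Z' (plie Z' F') y) (plie_rescaled lie1E)//.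
congr (_ * _); rewrite [RHS]/plie d_add//; first last.
- exact: smooth_mul.
- exact: smooth_plie.
by rewrite d_mul.
Qed.

Lemma plie_rescaled0 y : D y -> F y = 0 -> plie Z' F' y = plie Z F y.
Proof. by move=> Dy Fy; rewrite -lie1E// /lie1 Fy mul0r addr0. Qed.

Lemma d_rescaled0 y v : D y -> F y = 0 -> dder F' y v = b y * dder F y v.
Proof.
move=> Dy Fy; rewrite (d_ext _ F'E (smooth_mul sb sF) Dy) d_mul//.
by rewrite Fy mul0r addr0.
Qed.

Lemma d_plie_rescaled0 y v : D y -> F y = 0 ->
  dder (plie Z' F') y v = dder (plie Z F) y v + h y * dder F y v.
Proof.
move=> Dy Fy; rewrite (d_ext _ lie1E slie1 Dy) d_add//; first last.
- exact: smooth_mul.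
- exact: smooth_plie.
by rewrite d_mul// Fy mul0r add0r.
Qed.

Lemma plie2_rescaled0 y : D y -> F y = 0 -> plie Z F y = 0 ->
  iter 2 (plie Z') F' y = (b y)^-1 * iter 2 (plie Z) F y.
Proof. by move=> Dy F0 ZF0; rewrite -lie2E// /lie2 F0 ZF0 mul0r mulr0 !addr0. Qed.

(** Besides [b^-2 Z^3 F], two terms survive when [F = ZF = 0]: [b^-2 h Z^2 F], from differentiating
    [h ZF], and [- b^-3 (Zb) Z^2 F], from differentiating [1 / b]. They cancel because
    [h = Zb / b]. *)
Lemma plie3_rescaled0 y : D y -> F y = 0 -> plie Z F y = 0 ->
  iter 3 (plie Z') F' y = (b y)^-2 * iter 3 (plie Z) F y.
Proof.
move=> Dy F0 ZF0.
rewrite -[LHS]/(plie Z' (iter 2 (plie Z') F') y).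
rewrite (plie_rescaled lie2E)//; last exact: smooth_mul.
rewrite {1}/plie d_mul// d_inv// d_add//; first last.
- by apply: smooth_add; apply: smooth_mul => //; exact: smooth_plie.
- exact: smooth_iter_plie.
rewrite d_add//; [|by apply: smooth_mul => //; exact: smooth_plie..].
rewrite !d_mul//; [|exact: smooth_plie..].
rewrite -/(plie Z F y) -/(plie Z b y) -/(plie Z h y) F0 ZF0.
have -> : h y = (b y)^-1 * plie Z b y by [].
rewrite -[iter 3 _ _ _]/(dder (iter 2 (plie Z) F) y (0, Z y)).
rewrite -[iter 2 _ _ y]/(dder (plie Z F) y (0, Z y)).
field; exact: b0.
Qed.

End Rescaling.
End ParametricLie.

(** * Uniform local injectivity *)

Section LocalInjectivity.
Context {R : realType} {P : normedModType R}.
Variable D : set (P * 'rV[R]_2).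
Hypothesis oD : open D.

(** With [l] frozen, this is the one-variable mean value theorem along the segment [c] from [x] to
    [x'], whose velocity is [(0, x' - x)]. *)
Lemma smooth_MVT (f : P * 'rV[R]_2 -> R^o) l (x x' : 'rV[R]_2) : smooth D f ->
  (forall t : R, 0 <= t <= 1 -> D (l, x + t *: (x' - x))) ->
  exists2 t : R, 0 <= t <= 1 &
    f (l, x') - f (l, x) = dder f (l, x + t *: (x' - x)) (0, x' - x).
Proof.
move=> sf Dt; pose c (t : R) : P * 'rV[R]_2 := (l, x + t *: (x' - x)).
have dc t : is_diff t c (fun s => (0, s *: (x' - x))).
  apply: is_diff_pair; rewrite -[X in is_diff _ _ X]add0r; exact: is_diffD.
have df (t : R) : 0 <= t <= 1 ->
    is_derive t 1 (f \o c : R -> R^o) (dder f (c t) (0, x' - x)).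
  move=> t01; have dfc := smooth_diff sf (Dt t t01).
  have dfct : differentiable (f \o c : R -> R^o) t by apply: differentiable_comp.
  apply: DeriveDef; first exact: diff_derivable.
  rewrite deriveE// dderE diff_comp//= diff_val scale1r.
  by [].
have [||t] := @MVT_segment R (f \o c) (fun t => dder f (c t) (0, x' - x)) 0 1 ler01.
- by move=> t; rewrite in_itv/= => /andP[t0 t1]; apply: df; rewrite !ltW.
- apply: derivable_within_continuous => t; rewrite in_itv/= => /df dft.
  exact: ex_derive.
rewrite in_itv/= => t01; rewrite subr0 mulr1 /c/= scale1r subrKC scale0r addr0.
by exists t.
Qed.

Lemma ball_segment (x0 x x' : 'rV[R]_2) (e t : R) : ball x0 e x -> ball x0 e x' ->
  0 <= t <= 1 -> ball x0 e (x + t *: (x' - x)).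
Proof.
rewrite -ball_normE/= => hx hx' /andP[t0 t1].
have -> : x0 - (x + t *: (x' - x)) = (1 - t) *: (x0 - x) + t *: (x0 - x').
  by apply/rowP => j; rewrite !mxE; ring.
rewrite (le_lt_trans (ler_normD _ _))// !normrZ (ger0_norm t0).
rewrite ger0_norm ?subr_ge0//.
have -> : e = (1 - t) * e + t * e by ring.
(* For [t > 0] the strict inequality comes from the second summand, which vanishes at [t = 0]. *)
have [->|tn0] := eqVneq t 0; first by rewrite subr0 !mul1r !mul0r !addr0.
apply: ler_ltD; first by apply: ler_wpM2l; [rewrite subr_ge0|exact: ltW].
by rewrite ltr_pM2l// lt_def tn0.
Qed.

(** Cramer's rule: the determinant times each component of [w] is a combination of the two
    equations. *)
Lemma row2_kernel (p q r s : R) (w : 'rV[R]_2) : p * s - q * r != 0 ->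
  w 0 0 * p + w 0 1 * q = 0 -> w 0 0 * r + w 0 1 * s = 0 -> w = 0.
Proof.
move=> d0 h1 h2; rewrite [w]row2E.
have /eqP : w 0 0 * (p * s - q * r) = 0.
  by transitivity (s * (w 0 0 * p + w 0 1 * q) - q * (w 0 0 * r + w 0 1 * s));
    [ring|rewrite h1 h2; ring].
rewrite mulf_eq0 (negPf d0) orbF => /eqP ->.
have /eqP : w 0 1 * (p * s - q * r) = 0.
  by transitivity (p * (w 0 0 * r + w 0 1 * s) - r * (w 0 0 * p + w 0 1 * q));
    [ring|rewrite h1 h2; ring].
by rewrite mulf_eq0 (negPf d0) orbF => /eqP ->; rewrite !scale0r addr0.
Qed.

(** The mean value theorem puts [x' - x] in the kernel of a matrix of partial derivatives of [f] and
    [g], invertible near [(l0, x0)]. Uniformity in [l] comes from a product neighbourhood. *)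
Lemma locally_injective (f g : P * 'rV[R]_2 -> R^o) l0 x0 :
  smooth D f -> smooth D g -> D (l0, x0) ->
  dder f (l0, x0) (0, delta_mx 0 0) * dder g (l0, x0) (0, delta_mx 0 1) -
  dder f (l0, x0) (0, delta_mx 0 1) * dder g (l0, x0) (0, delta_mx 0 0) != 0 ->
  exists A B, [/\ nbhs l0 A, nbhs x0 B & forall l x x', A l -> B x -> B x' ->
    f (l, x) = f (l, x') -> g (l, x) = g (l, x') -> x = x'].
Proof.
move=> sf sg D0 det0; set y0 := (l0, x0) in D0 det0 *.
pose pf j y : R^o := dder f y (0, delta_mx 0 j).
pose pg j y : R^o := dder g y (0, delta_mx 0 j).
have cf j : pf j y @[y --> y0] --> pf j y0.
  by apply: smooth_continuous D0; exact: smooth_dder.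
have cg j : pg j y @[y --> y0] --> pg j y0.
  by apply: smooth_continuous D0; exact: smooth_dder.
(* The mean value theorem yields different intermediate points for [f] and [g], so the two rows of
   the determinant are taken at independent points [u.1] and [u.2]. *)
have cdet : (pf 0 u.1 * pg 1 u.2 - pf 1 u.1 * pg 0 u.2 : R^o) @[u --> (y0, y0)]
    --> (pf 0 y0 * pg 1 y0 - pf 1 y0 * pg 0 y0 : R^o).
  have c1 : u.1 @[u --> (y0, y0)] --> y0 by exact: cvg_fst.
  have c2 : u.2 @[u --> (y0, y0)] --> y0 by exact: cvg_snd.
  by apply: cvgB; apply: cvgM; [exact: (cvg_comp _ _ c1 (cf _))
    |exact: (cvg_comp _ _ c2 (cg _))|exact: (cvg_comp _ _ c1 (cf _))
    |exact: (cvg_comp _ _ c2 (cg _))].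
have [[S1 S2] [/= nS1 nS2] S12] := cvgr_neq0 _ cdet det0.
have [[A B] [/= nA nB] AB] : nbhs y0 (S1 `&` S2 `&` D).
  by apply: filterI; [exact: filterI|exact: open_nbhs_nbhs].
have /nbhs_ballP[e /= e0 eB] := nB.
exists A, (ball x0 e); split=> // [|l x x' Al xB x'B fE gE].
  exact: nbhsx_ballx.
have sD t : 0 <= t <= 1 -> (S1 `&` S2 `&` D) (l, x + t *: (x' - x)).
  by move=> t01; apply: AB; split=> //; apply: eB; exact: ball_segment.
have [t t01] := smooth_MVT sf (fun t t01 => (sD t t01).2).
have [s s01] := smooth_MVT sg (fun t t01 => (sD t t01).2).
rewrite fE gE !subrr !(d_row2 _ _ (x' - x)) => /esym g0 /esym f0.
apply/esym/subr0_eq; apply: row2_kernel f0 g0.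
by apply: (S12 (_, _)); split; [case: (sD t t01) => -[]|case: (sD s s01) => -[]].
Qed.

End LocalInjectivity.

(** * Two-dimensional linear algebra *)

Section Planar.
Context {R : realType}.
Implicit Types (u v w : 'rV[R]_2) (A : 'M[R]_2).

Definition wedge v w : R := v 0 0 * w 0 1 - v 0 1 * w 0 0.

Lemma det_mx2 A : \det A = A 0 0 * A 1 1 - A 0 1 * A 1 0.
Proof.
rewrite (expand_det_row _ 0) big_ord_recl big_ord1 /cofactor !det_mx11 !mxE /=.
rewrite (_ : lift 0 0 = 1 :> 'I_2); last exact: val_inj.
rewrite (_ : lift 1 0 = 0 :> 'I_2); last exact: val_inj.
by rewrite !addn0 addn1 expr0 expr1; ring.
Qed.

Lemma wedge_mul v w A : wedge (v *m A) (w *m A) = \det A * wedge v w.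
Proof.
have mulE u j : (u *m A) 0 j = u 0 0 * A 0 j + u 0 1 * A 1 j.
  rewrite mxE big_ord_recl big_ord1.
  by rewrite (_ : lift 0 0 = 1 :> 'I_2); last exact: val_inj.
by rewrite /wedge !mulE det_mx2; ring.
Qed.

Lemma wedgeDl v w s : wedge (v + s *: w) w = wedge v w.
Proof. by rewrite /wedge !mxE; ring. Qed.

Lemma wedgeZr v w s : wedge v (s *: w) = s * wedge v w.
Proof. by rewrite /wedge !mxE; ring. Qed.

Lemma wedge_shear v w r s : wedge (r *: v) (w + s *: v) = r * wedge v w.
Proof. by rewrite /wedge !mxE; ring. Qed.

(** If the wedge vanished, [v] would be a multiple of the nonzero covector [u], and [w] would kill
    it as it kills [u]. *)
Lemma wedge_neq0 w u v : u != 0 -> w 0 0 * u 0 0 + w 0 1 * u 0 1 = 0 ->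
  w 0 0 * v 0 0 + w 0 1 * v 0 1 != 0 -> wedge u v != 0.
Proof.
move=> u0 wu wv; apply: contra u0 => /eqP uv; apply/eqP; rewrite [u]row2E.
have /eqP : u 0 0 * (w 0 0 * v 0 0 + w 0 1 * v 0 1) = 0.
  by transitivity (v 0 0 * (w 0 0 * u 0 0 + w 0 1 * u 0 1) + w 0 1 * wedge u v);
    [rewrite /wedge; ring|rewrite wu uv; ring].
rewrite mulf_eq0 (negPf wv) orbF => /eqP ->.
have /eqP : u 0 1 * (w 0 0 * v 0 0 + w 0 1 * v 0 1) = 0.
  by transitivity (v 0 1 * (w 0 0 * u 0 0 + w 0 1 * u 0 1) - w 0 0 * wedge u v);
    [rewrite /wedge; ring|rewrite wu uv; ring].
by rewrite mulf_eq0 (negPf wv) orbF => /eqP ->; rewrite !scale0r addr0.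
Qed.

Lemma posdef_det A : A^T = A -> (forall v, v != 0 -> 0 < (v *m A *m v^T) 0 0) ->
  0 < \det A.
Proof.
move=> symA posA.
have quad v : (v *m A *m v^T) 0 0 = v 0 0 ^+ 2 * A 0 0
    + v 0 0 * v 0 1 * (A 0 1 + A 1 0) + v 0 1 ^+ 2 * A 1 1.
  rewrite mxE big_ord_recl big_ord1 !mxE !big_ord_recl !big_ord0.
  by rewrite (_ : lift 0 0 = 1 :> 'I_2); [ring|exact: val_inj].
have A10 : A 1 0 = A 0 1 by rewrite -[in LHS]symA mxE.
have A00 : 0 < A 0 0.
  have := posA (delta_mx 0 0); rewrite quad !mxE /= => h.
  have : 0 < 1 ^+ 2 * A 0 0 + 1 * 0 * (A 0 1 + A 1 0) + 0 ^+ 2 * A 1 1.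
    apply: h; apply/eqP => /rowP /(_ 0); rewrite !mxE /= => /eqP.
    by rewrite oner_eq0.
  by congr (0 < _); ring.
(* This vector is orthogonal to the first basis vector for the form [A], and the form takes the
   value [A 0 0 * \det A] on it. *)
pose v : 'rV[R]_2 := (- A 0 1) *: delta_mx 0 0 + A 0 0 *: delta_mx 0 1.
have v00 : v 0 0 = - A 0 1 by rewrite !mxE /=; ring.
have v01 : v 0 1 = A 0 0 by rewrite !mxE /=; ring.
have : 0 < A 0 0 * \det A.
  have := posA v; rewrite quad v00 v01 det_mx2 A10 => h.
  have {h} := h _; rewrite (_ : _ + _ = A 0 0 * (A 0 0 * A 1 1 - A 0 1 * A 0 1)).
    apply; apply/eqP => /rowP /(_ 1); rewrite v01 mxE => A00'.
    by rewrite A00' ltxx in A00.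
  by ring.
by rewrite pmulr_rgt0.
Qed.

End Planar.

(** * Charts *)

Section Charts.
Context {R : realType} {M : smooth_surface R}.
Implicit Types (a b : chart R M) (q : M) (U : set M).

(** The image is the part of the open chart range that the continuous [cinv] sends into [U]. *)
Lemma chart_image_open a U : open U -> open (cmap a @` (cdom a `&` U)).
Proof.
move=> oU; have cc : {in cmap a @` cdom a, continuous (cinv a)}.
  by move=> x /set_mem; exact: cinv_cts.
have := (continuous_inP _ (@crng_open _ _ a)).1 cc _ oU.
congr open; apply/seteqP; split=> x /=.
  by move=> [[q aq <-]]; rewrite cmapK// => Uq; exists q.
by move=> [q [aq Uq] <-]; split; [exists q|rewrite cmapK].
Qed.

Lemma near_cdom a q : cdom a q -> \forall q' \near q, cdom a q'.
Proof. by move=> aq; apply: open_nbhs_nbhs; split=> //; exact: cdom_open. Qed.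

Lemma differentiable_trans a b q : atlas a -> atlas b -> cdom a q -> cdom b q ->
  differentiable (trans a b) (cmap a q).
Proof.
move=> Aa Ab aq bq.
have oab : open (cmap a @` (cdom a `&` cdom b)).
  by apply: chart_image_open; exact: cdom_open.
have [/(smooth_onP _ oab) sab _] := atlas_compatible Aa Ab.
by have [d _] := sab 1%N; apply: d; exists q.
Qed.

Lemma transE a b q : cdom a q -> trans a b (cmap a q) = cmap b q.
Proof. by move=> aq; rewrite /trans /= cmapK. Qed.

(** Chain rule for [f' \o cinv b] after the transition map. Two functions are allowed because
    iterated Lie derivatives computed in different charts are only known to agree on the overlap. *)
Lemma d_trans a b U (f f' : M -> R) q v : atlas a -> atlas b -> open U -> U q ->
  cdom a q -> cdom b q ->
  (forall q', U q' -> cdom a q' -> cdom b q' -> f q' = f' q') ->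
  differentiable (f' \o cinv b : 'rV[R]_2 -> R^o) (cmap b q) ->
  'd (f \o cinv a : 'rV[R]_2 -> R^o) (cmap a q) v =
  'd (f' \o cinv b : 'rV[R]_2 -> R^o) (cmap b q) ('d (trans a b) (cmap a q) v).
Proof.
move=> Aa Ab oU Uq aq bq ff' df'; have dt := differentiable_trans Aa Ab aq bq.
rewrite -(transE b aq) in df' *.
have [|_ E] := @near_eq_differentiable _ _ _ ((f' \o cinv b) \o trans a b : _ -> R^o)
  (f \o cinv a) (cmap a q) _ (differentiable_comp dt df'); last first.
  apply: (etrans (congr1 (@^~ v) E)).
  exact: (congr1 (@^~ v) (diff_comp dt df')).
have oW : open (cdom b `&` U) by apply: openI => //; exact: cdom_open.
have : nbhs (cmap a q) (cmap a @` (cdom a `&` (cdom b `&` U))).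
  by apply: open_nbhs_nbhs; split; [exact: chart_image_open|exists q].
apply: filterS => _ [q' [aq' [bq' Uq']] <-].
by rewrite /trans /= !cmapK// ff'.
Qed.

End Charts.

(** * Families of functions and fields read in a chart *)

Section Coordinates.
Context {R : realType} {M : smooth_surface R} {P : normedModType R}.
Variables (L : set P) (U : set M).
Hypotheses (oL : open L) (oU : open U).
Implicit Types (a b : chart R M) (q : M) (l : P).

Definition cset a : set (P * 'rV[R]_2) :=
  [set y | L y.1 /\ (cmap a @` (cdom a `&` U)) y.2].

Definition cfun a (f : P -> M -> R) : P * 'rV[R]_2 -> R^o :=
  fun y => f y.1 (cinv a y.2).

Definition cvf a (V : P -> vfield M) : P * 'rV[R]_2 -> 'rV[R]_2 :=
  fun y => V y.1 a (cinv a y.2).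

Lemma cset_open a : open (cset a).
Proof.
have -> : cset a = fst @^-1` L `&` snd @^-1` (cmap a @` (cdom a `&` U)) by [].
apply: openI; apply: open_comp => //; last exact: chart_image_open.
  by move=> y _; exact: cvg_fst.
by move=> y _; exact: cvg_snd.
Qed.

Lemma cset_cmap a l q : L l -> U q -> cdom a q -> cset a (l, cmap a q).
Proof. by move=> Ll Uq aq; split=> //=; exists q. Qed.

Lemma smooth_ffamP f :
  smooth_ffam L U f <-> forall a, atlas a -> smooth (cset a) (cfun a f).
Proof.
by split=> sf a Aa; have [h1 h2] := smooth_onP (cfun a f) (@cset_open a);
  [apply: h1|apply: h2]; exact: sf.
Qed.

Lemma smooth_vfam_cvf V a : smooth_vfam L U V -> atlas a ->
  smooth_vf (cset a) (cvf a V).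
Proof.
move=> [_ sV] Aa j k; have CV := (smooth_onP (cvf a V) (@cset_open a)).1 (sV a Aa) k.
(* The projection to the [j]-th coordinate, bundled as a linear map for [Ck_linear]. *)
have @f : {linear 'rV[R]_2 -> R^o}.
  by exists (fun v : 'rV[R]_2 => v 0 j); do 2![eexists]; do ?[constructor];
     rewrite ?mxE// => ? *; rewrite ?mxE//; move=> ?; rewrite !mxE.
by apply: (Ck_linear (@cset_open a) _ CV (h := f)); exact: coord_continuous.
Qed.

(** In the chart, [f] is [F] composed with the slice [s] at fixed parameter, whose differential is
    [x |-> (0, x)]. *)
Lemma d_coord a (f : M -> R) (F : P * 'rV[R]_2 -> R^o) l q v :
  L l -> U q -> cdom a q -> smooth (cset a) F ->
  (forall q', U q' -> cdom a q' -> f q' = F (l, cmap a q')) ->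
  differentiable (f \o cinv a : 'rV[R]_2 -> R^o) (cmap a q) /\
  'd (f \o cinv a : 'rV[R]_2 -> R^o) (cmap a q) v = dder F (l, cmap a q) (0, v).
Proof.
move=> Ll Uq aq sF fF; pose s (x : 'rV[R]_2) : P * 'rV[R]_2 := (l, x).
have ds : is_diff (cmap a q) s (fun x => (0, x)) by exact: is_diff_pair.
have dF := smooth_diff sF (cset_cmap Ll Uq aq).
have dFs : differentiable (F \o s : 'rV[R]_2 -> R^o) (cmap a q).
  exact: differentiable_comp.
have [|? E] := @near_eq_differentiable _ _ _ (F \o s : _ -> R^o) (f \o cinv a)
  (cmap a q) _ dFs.
  have : nbhs (cmap a q) (cmap a @` (cdom a `&` U)).
    by apply: open_nbhs_nbhs; split; [exact: chart_image_open|exists q].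
  by apply: filterS => _ [q' [aq' Uq'] <-]; rewrite /s /= cmapK// fF.
split=> //; apply: (etrans (congr1 (@^~ v) E)).
rewrite dderE diff_comp//= diff_val.
by [].
Qed.

Variables (f : P -> M -> R) (V : P -> vfield M).

(** The induction is over all [q] at once, since the next derivative needs the equality near the
    point. *)
Lemma iter_lie_coord a l q k : L l -> U q -> atlas a -> cdom a q ->
  smooth (cset a) (cfun a f) -> smooth_vf (cset a) (cvf a V) ->
  iter k (lie a (V l)) (f l) q =
  iter k (plie (cvf a V)) (cfun a f) (l, cmap a q).
Proof.
move=> Ll + Aa + sf sV; elim: k q => [|k IH] q Uq aq; first by rewrite /= /cfun cmapK.
have [_ E] := d_coord (V l a q) Ll Uq aq
  (smooth_iter_plie (@cset_open a) k sV sf) (fun q' Uq' aq' => IH q' Uq' aq').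
by rewrite /= /lie E /plie /cvf /= cmapK.
Qed.

Lemma d_iter_lie_coord a l q k v : L l -> U q -> atlas a -> cdom a q ->
  smooth (cset a) (cfun a f) -> smooth_vf (cset a) (cvf a V) ->
  differentiable (iter k (lie a (V l)) (f l) \o cinv a : 'rV[R]_2 -> R^o) (cmap a q) /\
  'd (iter k (lie a (V l)) (f l) \o cinv a : 'rV[R]_2 -> R^o) (cmap a q) v =
  dder (iter k (plie (cvf a V)) (cfun a f)) (l, cmap a q) (0, v).
Proof.
move=> Ll Uq Aa aq sf sV; apply: d_coord => //.
  by apply: smooth_iter_plie => //; exact: cset_open.
by move=> q' Uq' aq'; exact: iter_lie_coord.
Qed.

(** At each step the chain rule replaces the direction [V l a q] by its image under the transition
    map, which is [V l b q] by the transformation law. *)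
Lemma iter_lie_chart a b l q k : L l -> U q -> atlas a -> atlas b ->
  cdom a q -> cdom b q -> is_vfield U (V l) ->
  (forall a, atlas a -> smooth (cset a) (cfun a f)) ->
  (forall a, atlas a -> smooth_vf (cset a) (cvf a V)) ->
  iter k (lie a (V l)) (f l) q = iter k (lie b (V l)) (f l) q.
Proof.
move=> Ll + Aa Ab + + hV sf sV; elim: k q => [//|k IH] q Uq aq bq.
have [db _] := d_iter_lie_coord k 0 Ll Uq Ab bq (sf b Ab) (sV b Ab).
apply: (etrans (d_trans (V l a q) Aa Ab oU Uq aq bq IH db)).
by rewrite iterS /lie (hV a b q).
Qed.

End Coordinates.

(** * Factorization equivalence *)

Section Triplets.
Context {R : realType} {n : nat} {M : smooth_surface R}.
Variables (L : set 'rV[R]_n) (U : set M).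
Hypotheses (oL : open L) (oU : open U).
Implicit Types (a : chart R M) (b : 'rV[R]_n -> M -> R) (q : M).
Implicit Types (l : 'rV[R]_n) (T : triplet n M).

Local Notation D a := (cset L U a).

Lemma csetE a y : D a y -> [/\ L y.1, U (cinv a y.2) & cdom a (cinv a y.2)].
Proof. by move=> [Ly [q [aq Uq] <-]]; rewrite cmapK. Qed.

Definition csmooth_chart T a :=
  smooth (D a) (cfun a (tF T)) /\ smooth_vf (D a) (cvf a (tZ T)).

Definition csmooth T := forall a, atlas a -> csmooth_chart T a.

Lemma smooth_triplet_csmooth T : smooth_triplet L U T -> csmooth T.
Proof.
move=> [sF sZ _] a Aa; split; last exact: smooth_vfam_cvf.
exact: (smooth_ffamP oL oU _).1.
Qed.

(* The relation generated by the elementary moves of fact_equiv: the composite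
   of all rescalings is one rescaling by b, and Q changes along the critical
   curve by a multiple of Z. *)
Definition rescaling (b : 'rV[R]_n -> M -> R) T T' :=
  [/\ smooth_ffam L U b,
      (forall l q, L l -> U q -> b l q != 0),
      (forall l q, L l -> U q -> tF T' l q = b l q * tF T l q),
      (forall l a q, L l -> atlas a -> U q -> cdom a q ->
         tZ T' l a q = (b l q)^-1 *: tZ T l a q) &
      (forall l a q, L l -> atlas a -> U q -> cdom a q -> tF T l q = 0 ->
         exists s, tQ T' l a q = tQ T l a q + s *: tZ T l a q)].

Lemma rescaling1 T T' :
  (forall l q, L l -> U q -> tF T' l q = tF T l q) ->
  (forall l a q, L l -> atlas a -> U q -> cdom a q ->
     tZ T' l a q = tZ T l a q) ->
  (forall l a q, L l -> atlas a -> U q -> cdom a q -> tF T l q = 0 ->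
     exists s, tQ T' l a q = tQ T l a q + s *: tZ T l a q) ->
  rescaling (fun _ _ => 1) T T'.
Proof.
move=> hF hZ hQ; split=> //.
- by apply/smooth_ffamP => // a _ k; exact: (Ck_cst k (D a) (1 : R^o)).
- by move=> l q Ll Uq; rewrite mul1r hF.
- by move=> l a q Ll Aa Uq aq; rewrite invr1 scale1r hZ.
Qed.

Lemma rescaling_sym b T T' :
  rescaling b T T' -> rescaling (fun l q => (b l q)^-1) T' T.
Proof.
move=> [sb b0 hF hZ hQ]; split.
- apply/smooth_ffamP => // a Aa.
  have oD : open (D a) by exact: cset_open.
  apply: (@smooth_inv _ _ _ oD (cfun a b)).
    by move=> y /csetE[Ly Uy _]; exact: b0.
  exact: (smooth_ffamP oL oU _).1.
- by move=> l q Ll Uq; rewrite invr_neq0 ?b0.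
- by move=> l q Ll Uq; rewrite hF// mulKf ?b0.
- by move=> l a q Ll Aa Uq aq; rewrite hZ// scalerA invrK divff ?b0// scale1r.
- move=> l a q Ll Aa Uq aq; rewrite hF// => /eqP.
  rewrite mulf_eq0 (negPf (b0 _ _ Ll Uq)) => /eqP F0.
  (* Since [Z = b Z'], the relation [Q' = Q + s Z] solves to [Q = Q' - s b Z']. *)
  have [s E] := hQ l a q Ll Aa Uq aq F0; exists (- s * b l q).
  by rewrite hZ// scalerA mulfK ?b0// E -addrA -scalerDl subrr scale0r addr0.
Qed.

Lemma rescaling_trans b b' T T' T'' : rescaling b T T' -> rescaling b' T' T'' ->
  rescaling (fun l q => b' l q * b l q) T T''.
Proof.
move=> [sb b0 hF hZ hQ] [sb' b'0 hF' hZ' hQ']; split.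
- apply/smooth_ffamP => // a Aa.
  have oD : open (D a) by exact: cset_open.
  by apply: (@smooth_mul _ _ _ oD (cfun a b') (cfun a b));
    apply: (smooth_ffamP oL oU _).1.
- by move=> l q Ll Uq; rewrite mulf_neq0 ?b0 ?b'0.
- by move=> l q Ll Uq; rewrite hF'// hF// mulrA.
- by move=> l a q Ll Aa Uq aq; rewrite hZ'// hZ// scalerA invfM.
- move=> l a q Ll Aa Uq aq F0.
  have [s E] := hQ l a q Ll Aa Uq aq F0.
  have F'0 : tF T' l q = 0 by rewrite hF// F0 mulr0.
  (* The second multiple is of [Z' = Z / b], whence the division. *)
  have [s' E'] := hQ' l a q Ll Aa Uq aq F'0; exists (s + s' / b l q).
  by rewrite E' E hZ// scalerA -addrA -scalerDl.
Qed.

(** Collapses a chain of moves into one rescaling, so that invariance has to be checked only once;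
    moves that alter only Q have [b = 1]. *)
Lemma fact_equiv_rescaling T T' : fact_equiv L U T T' -> exists b, rescaling b T T'.
Proof.
elim=> {T T'} [T|T T' _ [b h]|T T' T'' _ [b h] _ [b' h']|T T' c _ hF hZQ|
  T T' b sb b0 hF hZQ|T T' _ _ hF hZQ].
- exists (fun _ _ => 1); apply: rescaling1 => // l a q *.
  by exists 0; rewrite scale0r addr0.
- by exists (fun l q => (b l q)^-1); exact: rescaling_sym.
- by exists (fun l q => b' l q * b l q); exact: rescaling_trans h'.
- exists (fun _ _ => 1); apply: rescaling1 => // l a q Ll Aa Uq aq.
    by have [] := hZQ l a q Ll Aa Uq aq.
  by exists (c l q); have [] := hZQ l a q Ll Aa Uq aq.
- exists b; split=> // l a q Ll Aa Uq aq; have [//] := hZQ l a q Ll Aa Uq aq.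
  by move=> _ -> _; exists 0; rewrite scale0r addr0.
- exists (fun _ _ => 1); apply: rescaling1 => // l a q Ll Aa Uq aq.
    by have [] := hZQ l a q Ll Aa Uq aq.
  move=> F0; have [_ ->//] := hZQ l a q Ll Aa Uq aq.
  by exists 0; rewrite scale0r addr0.
Qed.

Lemma dform_coord T a l q k j : csmooth_chart T a -> L l -> U q -> atlas a ->
  cdom a q -> dform a (iter k (lie a (tZ T l)) (tF T l)) q 0 j =
  dder (iter k (plie (cvf a (tZ T))) (cfun a (tF T))) (l, cmap a q)
    (0, delta_mx 0 j).
Proof.
move=> [sF sZ] Ll Uq Aa aq; rewrite mxE.
by have [] := d_iter_lie_coord oL oU k (delta_mx 0 j) Ll Uq Aa aq sF sZ.
Qed.

(* The value of calG, once the metric and the orientation have cancelled. *)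
Definition calW T a l q : R := wedge (tQ T l a q) (tZ T l a q) *
  wedge (dform a (tF T l) q) (dform a (lie a (tZ T l) (tF T l)) q).

Lemma calG_calW g o T a l q : is_metric g -> is_orientation U o -> U q ->
  atlas a -> cdom a q -> calG g o T a l q = calW T a l q.
Proof.
move=> [_ symg posg _] ho Uq Aa aq; case: (ho a q Aa Uq aq) => o1 _ _.
have dg : 0 < \det (g a q).
  apply: posdef_det; first exact: symg.
  by move=> v v0; exact: posg.
have oo : o a q * o a q = 1 by case: o1 => ->; rewrite ?mulrNN mulr1.
rewrite /calG /area_form /grad -/(wedge _ _) -/(wedge (_ *m _) _) wedge_mul det_inv.
set s := Num.sqrt _; set W := wedge (tQ _ _ _ _) _; set W' := wedge (dform _ _ _) _.
(* The sign squares to 1, and the middle factor is 1 because [\det (g a q)] is positive. *)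
transitivity ((o a q * o a q) * (s ^+ 2 * (\det (g a q))^-1) * (W * W')); first by ring.
by rewrite oo sqr_sqrtr ?ltW// divff ?gt_eqF// !mul1r.
Qed.

(** Vectors are pushed from [a] to [a'] by [J], covectors pulled back from [a'] to [a] by its
    transpose; the same [\det J] thus moves from one wedge to the other, without inverting [J]. *)
Lemma calW_chart T a a' l q : csmooth T -> is_vfield U (tZ T l) ->
  is_vfield U (tQ T l) -> L l -> U q -> atlas a -> atlas a' -> cdom a q ->
  cdom a' q -> calW T a l q = calW T a' l q.
Proof.
move=> sT vZ vQ Ll Uq Aa Aa' aq a'q.
pose J := jacobian (trans a a') (cmap a q).
have VE V : is_vfield U V -> V a' q = V a q *m J.
  by move=> vV; rewrite (vV a a' q)// /J mul_rV_lin1.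
have dE k : dform a (iter k (lie a (tZ T l)) (tF T l)) q =
    dform a' (iter k (lie a' (tZ T l)) (tF T l)) q *m J^T.
  have [sF sZ] := sT a' Aa'; apply/rowP => j.
  have [dk _] := d_iter_lie_coord oL oU k 0 Ll Uq Aa' a'q sF sZ.
  have fE q' : U q' -> cdom a q' -> cdom a' q' ->
      iter k (lie a (tZ T l)) (tF T l) q' = iter k (lie a' (tZ T l)) (tF T l) q'.
    move=> Uq' aq' a'q'; apply: (iter_lie_chart oL oU k Ll Uq' Aa Aa' aq' a'q' vZ);
    by move=> a0 Aa0; have [] := sT a0 Aa0.
  rewrite mxE; apply: (etrans (d_trans (delta_mx 0 j) Aa Aa' oU Uq aq a'q fE dk)).
  rewrite [in LHS](row2E ('d _ _ _)) linearD !linearZ.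
  rewrite mxE big_ord_recl big_ord1 !mxE.
  rewrite (_ : lift 0 0 = 1 :> 'I_2); last exact: val_inj.
  by congr (_ + _); rewrite mulrC.
rewrite /calW (dE 0) (dE 1) wedge_mul det_tr !VE// wedge_mul.
by rewrite mulrCA mulrA.
Qed.

(** * Invariance under one rescaling *)

Section Rescaled.
Variables (T T' : triplet n M) (b : 'rV[R]_n -> M -> R).
Hypotheses (sT : csmooth T) (bTT' : rescaling b T T').
Variables (a : chart R M) (Aa : atlas a).

Let oD : open (D a). Proof. exact: cset_open. Qed.

Let sb : smooth (D a) (cfun a b).
Proof. by case: bTT' => sb _ _ _ _; exact: (smooth_ffamP oL oU _).1. Qed.

Let b0 y : D a y -> cfun a b y != 0.
Proof. by case: bTT' => _ h _ _ _ /csetE[Ly Uy _]; exact: h. Qed.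

Let F'E y : D a y -> cfun a b y * cfun a (tF T) y = cfun a (tF T') y.
Proof. by case: bTT' => _ _ h _ _ /csetE[Ly Uy _]; rewrite /cfun h. Qed.

Let Z'E y : D a y -> cvf a (tZ T') y = (cfun a b y)^-1 *: cvf a (tZ T) y.
Proof. by case: bTT' => _ _ _ h _ /csetE[Ly Uy ay]; rewrite /cvf h. Qed.

Lemma csmooth_chart_rescaled : csmooth_chart T' a.
Proof.
have [sF sZ] := sT Aa.
split; [exact: smooth_rescaled F'E|exact: smooth_vf_rescaled Z'E].
Qed.

Variables (l : 'rV[R]_n) (q : M) (Ll : L l) (Uq : U q) (aq : cdom a q).
Hypothesis F0 : tF T l q = 0.

Let Dy : D a (l, cmap a q). Proof. exact: cset_cmap. Qed.

Let cF0 : cfun a (tF T) (l, cmap a q) = 0.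
Proof. by rewrite /cfun /= cmapK. Qed.

Let cb : cfun a b (l, cmap a q) = b l q.
Proof. by rewrite /cfun /= cmapK. Qed.

Let lieE k : iter k (lie a (tZ T l)) (tF T l) q =
  iter k (plie (cvf a (tZ T))) (cfun a (tF T)) (l, cmap a q).
Proof. by have [sF sZ] := sT Aa; exact: (iter_lie_coord oL oU k Ll Uq Aa aq). Qed.

Let lie'E k : iter k (lie a (tZ T' l)) (tF T' l) q =
  iter k (plie (cvf a (tZ T'))) (cfun a (tF T')) (l, cmap a q).
Proof.
have [sF sZ] := csmooth_chart_rescaled.
exact: (iter_lie_coord oL oU k Ll Uq Aa aq).
Qed.

Lemma lie1_rescaled : lie a (tZ T' l) (tF T' l) q = lie a (tZ T l) (tF T l) q.
Proof.
have [sF sZ] := sT Aa.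
apply: (etrans (lie'E 1)); apply: (etrans _ (esym (lieE 1))).
exact: (plie_rescaled0 oD sF sb b0 F'E Z'E Dy cF0).
Qed.

Let dFE T0 j : csmooth_chart T0 a -> dform a (tF T0 l) q 0 j =
  dder (cfun a (tF T0)) (l, cmap a q) (0, delta_mx 0 j).
Proof. by move=> sT0; exact: (dform_coord 0 j sT0 Ll Uq Aa aq). Qed.

Let dZFE T0 j : csmooth_chart T0 a ->
  dform a (lie a (tZ T0 l) (tF T0 l)) q 0 j =
  dder (plie (cvf a (tZ T0)) (cfun a (tF T0))) (l, cmap a q) (0, delta_mx 0 j).
Proof. by move=> sT0; exact: (dform_coord 1 j sT0 Ll Uq Aa aq). Qed.

Lemma calW_rescaled : calW T' a l q = calW T a l q.
Proof.
have sTa := sT Aa; have [sF sZ] := sTa; have sT'a := csmooth_chart_rescaled.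
have [_ b0q _ hZ hQ] := bTT'; have [s E] := hQ l a q Ll Aa Uq aq F0.
have dF : dform a (tF T' l) q = b l q *: dform a (tF T l) q.
  apply/rowP => j; rewrite [RHS]mxE; apply: (etrans (dFE j sT'a)).
  rewrite -cb; apply: (etrans (d_rescaled0 oD sF sb F'E _ Dy cF0)).
  exact: (congr1 _ (esym (dFE j sTa))).
pose h : R := (cfun a b (l, cmap a q))^-1 *
  plie (cvf a (tZ T)) (cfun a b) (l, cmap a q).
have dZF : dform a (lie a (tZ T' l) (tF T' l)) q =
    dform a (lie a (tZ T l) (tF T l)) q + h *: dform a (tF T l) q.
  apply/rowP => j; rewrite [RHS]mxE [X in _ = _ + X]mxE.
  apply: (etrans (dZFE j sT'a)).
  apply: (etrans (d_plie_rescaled0 oD sF sb sZ b0 F'E Z'E _ Dy cF0)).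
  exact: (congr2 (fun u v => u + h * v) (esym (dZFE j sTa)) (esym (dFE j sTa))).
(* The first wedge ignores the multiple of Z added to Q and gains [b^-1]; the second ignores the
   shear by [h] and gains [b]. *)
rewrite /calW dF dZF E hZ// wedgeZr wedgeDl wedge_shear.
by rewrite mulrACA mulVf ?mul1r ?b0q.
Qed.

Hypothesis ZF0 : lie a (tZ T l) (tF T l) q = 0.

Let cZF0 : plie (cvf a (tZ T)) (cfun a (tF T)) (l, cmap a q) = 0.
Proof. by rewrite -ZF0; exact: (esym (lieE 1)). Qed.

Lemma lie2_rescaled : iter 2 (lie a (tZ T' l)) (tF T' l) q =
  (b l q)^-1 * iter 2 (lie a (tZ T l)) (tF T l) q.
Proof.
have [sF sZ] := sT Aa; rewrite (lieE 2) (lie'E 2) -cb.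
exact: (plie2_rescaled0 oD sF sb sZ b0 F'E Z'E Dy cF0 cZF0).
Qed.

Lemma lie3_rescaled : iter 3 (lie a (tZ T' l)) (tF T' l) q =
  (b l q) ^- 2 * iter 3 (lie a (tZ T l)) (tF T l) q.
Proof.
have [sF sZ] := sT Aa; rewrite (lieE 3) (lie'E 3) -cb.
exact: (plie3_rescaled0 oD sF sb sZ b0 F'E Z'E Dy cF0 cZF0).
Qed.

Lemma calA_rescaled : calA T' a l q = calA T a l q.
Proof.
have b0q : b l q != 0 by case: bTT' => _ + _ _ _; exact.
rewrite /calA lie2_rescaled lie3_rescaled exprMn exprVn.
by rewrite -mulf_div divff ?mul1r// invr_eq0 expf_neq0.
Qed.

End Rescaled.

End Triplets.

(** * Contact points *)

Section ContactPoints.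
Context {R : realType} {n : nat} {M : smooth_surface R}.
Variables (L : set 'rV[R]_n) (U : set M).
Hypotheses (oL : open L) (oU : open U).
Implicit Types (a : chart R M) (q : M) (l : 'rV[R]_n) (T : triplet n M).

(** [fact_equiv] does not itself demand that F and Z be smooth, so their smoothness is transported
    from [T]. *)
Lemma csmooth_rescaled b T T' : csmooth L U T -> rescaling L U b T T' ->
  csmooth L U T'.
Proof. by move=> sT bTT' a Aa; exact: csmooth_chart_rescaled bTT' _ Aa. Qed.

Lemma crit_curve_rescaled b T T' l : rescaling L U b T T' -> L l ->
  crit_curve U T' l = crit_curve U T l.
Proof.
move=> [_ b0 hF _ _] Ll; apply/seteqP; split=> q [Uq F0]; split=> //.
  by apply/eqP; move/eqP: F0; rewrite hF// mulf_eq0 (negPf (b0 _ _ Ll Uq)).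
by rewrite hF// F0 mulr0.
Qed.

Lemma generic_contact_rescaled b T T' l q : csmooth L U T ->
  rescaling L U b T T' -> L l -> U q ->
  generic_contact T l q -> generic_contact T' l q.
Proof.
move=> sT bTT' Ll Uq [F0 hZ]; have [_ b0 hF _ _] := bTT'.
split=> [|a Aa aq]; first by rewrite hF// F0 mulr0.
have [Z0 Z2] := hZ a Aa aq.
rewrite (lie1_rescaled oL oU sT bTT' Aa Ll Uq aq F0).
rewrite (lie2_rescaled oL oU sT bTT' Aa Ll Uq aq F0 Z0).
by rewrite mulf_neq0// invr_neq0// b0.
Qed.

Lemma contact_family_rescaled b T T' l0 p c : csmooth L U T ->
  rescaling L U b T T' -> contact_family L U T l0 p c ->
  contact_family L U T' l0 p c.
Proof.
move=> sT bTT' [cp [B [oB Bl0 cc sc hB]]]; split=> //; exists B; split=> // l Bl.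
by have [Ll Ucl gc] := hB l Bl; split=> //; exact: (generic_contact_rescaled sT bTT').
Qed.

(* At a generic contact point dF and d(ZF) are independent, as dF kills Z but
   d(ZF) does not; so (F, ZF) is injective near it, uniformly in the parameter. *)
Lemma contact_family_unique T l0 p c c' : csmooth L U T ->
  (forall a, atlas a -> cdom a p -> dform a (tF T l0) p != 0) ->
  contact_family L U T l0 p c -> contact_family L U T l0 p c' ->
  \forall l \near l0, c' l = c l.
Proof.
move=> sT dF0 [cp [B [oB Bl0 cc _ hB]]] [c'p [B' [oB' B'l0 cc' _ hB']]].
have [a Aa ap] := atlas_cover p; have [sF sZ] := sT a Aa.
have [Ll0 Up [F0 hZ]] := hB l0 Bl0; rewrite cp in Up F0 hZ.
have [Z0 Z2] := hZ a Aa ap; have D0 := cset_cmap Ll0 Up ap.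
have sZF : smooth (cset L U a) (plie (cvf a (tZ T)) (cfun a (tF T))).
  by apply: smooth_plie => //; exact: cset_open.
have dE k j : dform a (iter k (lie a (tZ T l0)) (tF T l0)) p 0 j =
    dder (iter k (plie (cvf a (tZ T))) (cfun a (tF T))) (l0, cmap a p)
      (0, delta_mx 0 j).
  exact: (dform_coord oL oU k j (sT a Aa)).
(* The Lie derivative as a pairing of a covector with Z, the form in which [wedge_neq0] takes it. *)
have lE k : iter k.+1 (lie a (tZ T l0)) (tF T l0) p =
    tZ T l0 a p 0 0 * dform a (iter k (lie a (tZ T l0)) (tF T l0)) p 0 0 +
    tZ T l0 a p 0 1 * dform a (iter k (lie a (tZ T l0)) (tF T l0)) p 0 1.
  rewrite (iter_lie_coord oL oU k.+1 Ll0 Up Aa ap sF sZ) iterS {1}/plie d_row2.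
  have -> : cvf a (tZ T) (l0, cmap a p) = tZ T l0 a p by rewrite /cvf /= cmapK.
  by rewrite (dE k 0) (dE k 1).
have W0 : wedge (dform a (tF T l0) p) (dform a (lie a (tZ T l0) (tF T l0)) p) != 0.
  by apply: (wedge_neq0 (w := tZ T l0 a p)); 
    [exact: dF0|exact: (etrans (esym (lE 0)) Z0)|move: Z2; rewrite (lE 1)].
have [|A [C [nA nC inj]]] := locally_injective (@cset_open _ _ _ _ _ oL oU a)
  sF sZF D0.
  apply: contra W0 => /eqP det0; apply/eqP; apply: etrans det0.
  exact: (congr2 (fun u v => u - v) (congr2 *%R (dE 0 0) (dE 1 1))
                                    (congr2 *%R (dE 0 1) (dE 1 0))).
have near_chart d : d l0 = p -> {for l0, continuous d} ->
    \forall l \near l0, cdom a (d l) /\ C (cmap a (d l)).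
  move=> dp cd; have nd : d l @[l --> l0] --> p by rewrite -dp.
  have nC' : \forall q \near p, C (cmap a q) by exact: (cmap_cts ap).
  exact: (nd _ (filterI (near_cdom ap) nC')).
(* In the chart, the points of either family are zeros of (F, ZF), so injectivity will identify
   them. *)
have coord0 d l : L l -> U (d l) -> cdom a (d l) ->
    generic_contact T l (d l) -> cfun a (tF T) (l, cmap a (d l)) = 0 /\
    plie (cvf a (tZ T)) (cfun a (tF T)) (l, cmap a (d l)) = 0.
  move=> Ll Udl adl [F0l hZl]; have [Z0l _] := hZl a Aa adl.
  split; first by rewrite /cfun /= cmapK.
  by rewrite -Z0l; exact: (esym (iter_lie_coord oL oU 1 Ll Udl Aa adl sF sZ)).
near=> l.
have Bl : B l by near: l; exact: open_nbhs_nbhs.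
have B'l : B' l by near: l; exact: open_nbhs_nbhs.
have [Ll Ucl gc] := hB l Bl; have [_ Uc'l gc'] := hB' l B'l.
have [acl Ccl] : cdom a (c l) /\ C (cmap a (c l)).
  by near: l; exact: near_chart (cc _ Bl0).
have [ac'l Cc'l] : cdom a (c' l) /\ C (cmap a (c' l)).
  by near: l; exact: near_chart (cc' _ B'l0).
have [f0 g0] := coord0 c l Ll Ucl acl gc.
have [f'0 g'0] := coord0 c' l Ll Uc'l ac'l gc'.
have Al : A l by near: l.
rewrite -(cmapK ac'l) -(cmapK acl); congr cinv.
by apply: (inj l) => //; rewrite ?f0 ?f'0 ?g0 ?g'0.
Unshelve. all: by end_near. Qed.

End ContactPoints.

Theorem theorem1 (R : realType) (n : nat) (M : smooth_surface R)
    (g : tensor2 M) (hg : is_metric g)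
    (p : M) (U : set M) (hU : open U) (hUp : U p)
    (L : set 'rV[R]_n) (hL : open L) (l0 : 'rV[R]_n) (hl0 : L l0)
    (o : chart R M -> M -> R) (ho : is_orientation U o)
    (e0 : R) (he0 : 0 < e0)
    (X : R^o * 'rV[R]_n -> vfield M) (T : triplet n M)
    (hX : slow_fast e0 L U X T)
    (hA1 : A1 L U T l0 p) (hA2 : A2 L T p) (hA3 : A3 T l0 p)
    (c : 'rV[R]_n -> M) (hc : contact_family L U T l0 p c) :
  exists (G : 'rV[R]_n -> M -> R) (A : 'rV[R]_n -> R),
    (forall T' : triplet n M, fact_equiv L U T T' ->
      [/\ (forall l, L l -> crit_curve U T' l = crit_curve U T l),
          (forall o' l q a, is_orientation U o' -> L l -> crit_curve U T l q ->
             atlas a -> cdom a q -> calG g o' T' a l q = G l q),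
          contact_family L U T' l0 p c &
          forall c', contact_family L U T' l0 p c' ->
            \forall l \near l0, forall a, atlas a -> cdom a (c' l) ->
              iter 2 (lie a (tZ T' l)) (tF T' l) (c' l) != 0 /\
              calA T' a l (c' l) = A l])
    /\
    (forall (g' : tensor2 M) o' q a, is_metric g' -> is_orientation U o' ->
       crit_curve U T l0 q -> atlas a -> cdom a q ->
       calG g' o' T a l0 q = G l0 q).
Proof.
case: hX => _ hT _; have sT := smooth_triplet_csmooth hL hU hT.
have [hF [vZ _] [vQ _]] := hT; case: hA1 => _ _ dF0.
have dF0p a : atlas a -> cdom a p -> dform a (tF T l0) p != 0.
  by apply: dF0 => //; split=> //; exact: hA3.1.
(* The invariants must not mention a chart, so one is chosen around each point; [calWE] and
   [iter_lie_chart] show that the choice is immaterial. *)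
have [ch hch] : {ch : M -> chart R M & forall q, atlas (ch q) /\ cdom (ch q) q}.
  apply: (@choice _ _ (fun q a => atlas a /\ cdom a q)) => q.
  by have [a Aa aq] := atlas_cover q; exists a.
have calWE a l q : L l -> U q -> atlas a -> cdom a q ->
    calW T a l q = calW T (ch q) l q.
  move=> Ll Uq Aa aq; have [Ac cq] := hch q.
  by apply: (calW_chart hL hU sT) => //; [exact: vZ|exact: vQ].
(* The first witness contains neither metric nor orientation, which gives the last clause for an
   arbitrary metric. *)
exists (fun l q => calW T (ch q) l q), (fun l => calA T (ch (c l)) l (c l)).
split=> [T' /(fact_equiv_rescaling hL hU)[b bTT']|]; last first.
  move=> g' o' q a hg' ho' [Uq _] Aa aq.
  exact: (etrans (calG_calW T l0 hg' ho' Uq Aa aq) (calWE _ _ _ hl0 Uq Aa aq)).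
have sT' := csmooth_rescaled hL hU sT bTT'.
have bT'T := rescaling_sym hL hU bTT'.
split.
- by move=> l; exact: (crit_curve_rescaled bTT').
- move=> o' l q a ho' Ll [Uq F0] Aa aq;
  apply: (etrans (calG_calW T' l hg ho' Uq Aa aq)).
  apply: (etrans (calW_rescaled hL hU sT bTT' Aa Ll Uq aq F0)).
  exact: calWE.
- exact: (contact_family_rescaled hL hU sT bTT').
(* The inverse rescaling makes [c'] a contact family of [T] as well, hence equal to [c] near
   [l0]. *)
move=> c' hc'; have hc'T := contact_family_rescaled hL hU sT' bT'T hc'.
have [_ [B' [oB' B'l0 _ _ hB']]] := hc'.
have [_ [B [oB Bl0 _ _ hB]]] := hc.
near=> l.
have Bl : B l by near: l; exact: open_nbhs_nbhs.
have B'l : B' l by near: l; exact: open_nbhs_nbhs.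
have c'cl : c' l = c l.
  by near: l; exact: (contact_family_unique hL hU sT dF0p hc hc'T).
move=> a Aa ac'l; have [_ _ [_ /(_ a Aa ac'l)[_ Z2]]] := hB' l B'l.
split=> //; rewrite c'cl in ac'l *.
have [Ll Ucl [F0 hZ]] := hB l Bl; have [Z0 _] := hZ a Aa ac'l.
rewrite (calA_rescaled hL hU sT bTT' Aa Ll Ucl ac'l F0 Z0).
have [Ac cc] := hch (c l).
have lieE k : iter k (lie a (tZ T l)) (tF T l) (c l) =
    iter k (lie (ch (c l)) (tZ T l)) (tF T l) (c l).
  by apply: (iter_lie_chart hL hU k Ll Ucl Aa Ac ac'l cc (vZ l Ll)) => a' Aa';
    have [] := sT a' Aa'.
by rewrite /calA !lieE.
Unshelve. all: by end_near. Qed.
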